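(* Let $k$ be a commutative ring, $A$ a commutative $k$-algebra, $I\subseteq A$ an ideal and $p\geq 2$ an integer. Suppose that $A$ satisfies condition $H^I_{p,a}$ for some integer $a\geq 1$. Let $e,s\geq 1$ be integers with $s\leq a$, and let $D\in\operatorname{HS}_k(A;ep^s)$ be an $(ep^s-1)$-$I$-logarithmic Hasse-Schmidt derivation with $\ell(D)\geq e$. Then there exists $D'\in\operatorname{HS}_k(A;p^s)$ which is an integral of $D_e$ (i.e. $D'_1=D_e$), such that $D'$ is $(p^s-1)$-$I$-logarithmic and $D'_{p^s}=D_{ep^s}+H$, where $H$ is an $I$-logarithmic differential operator.
   Context: For a commutative ring $k$, a commutative $k$-algebra $A$ and an integer $m\geq 1$, a Hasse-Schmidt derivation of $A$ over $k$ of length $m$ is a sequence $D=(D_0,D_1,\ldots,D_m)$ of $k$-linear maps $D_n:A\to A$ with $D_0=\mathrm{Id}_A$ and $D_n(xy)=\sum_{i+j=n}D_i(x)D_j(y)$ for all $x,y\in A$ and all $n\le m$. The set of these is $\operatorname{HS}_k(A;m)$; the identity is $\mathrm{Id}=(\mathrm{Id}_A,0,\ldots,0)$. Put $\ell(D)=\min\{h\geq 1: D_h\neq 0\}$ if $D\ne \mathrm{Id}$, and $\ell(\mathrm{Id})=\infty$. Let $I\subseteq A$ be an ideal. $D\in\operatorname{HS}_k(A;m)$ is $I$-logarithmic if $D_i(I)\subseteq I$ for all $i$; the set of these is $\operatorname{HS}_k(\log I;m)$. For $r<m$, $D$ is $r$-$I$-logarithmic if $D_i(I)\subseteq I$ for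 all $i\leq r$. A ($k$-linear) differential operator $H:A\to A$ is $I$-logarithmic if $H(I)\subseteq I$. $\operatorname{IDer}_k(\log I;n)$ denotes the set of $k$-derivations $\delta$ of $A$ for which there is $D\in\operatorname{HS}_k(\log I;n)$ with $D_1=\delta$. Condition $H^I_{p,a}$ ($a\geq1$, $p\geq 2$ integers): for every positive integer $M$ with $1<M<p^a$ which is not a power of $p$, $\operatorname{IDer}_k(\log I;M-1)=\operatorname{IDer}_k(\log I;M)$. *)

(* Defs.v *)
From HB Require Import structures.
From mathcomp Require Import all_boot all_order all_algebra.
From mathcomp Require Import boolp classical_sets.
Set Implicit Arguments.
Unset Strict Implicit.
Unset Printing Implicit Defensive.
Import GRing.Theory.
Local Open Scope classical_set_scope.
Local Open Scope ring_scope.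

(* A commutative k-algebra A is given by its structure morphism
   phi : {rmorphism k -> A} between commutative rings; unlike comAlgType k,
   this allows A to be the zero ring. *)

Definition klinear (k A : comPzRingType) (phi : {rmorphism k -> A})
    (f : A -> A) : Prop :=
  {morph f : x y / x + y} /\ (forall c : k, {morph f : x / phi c * x}).

Definition is_ideal (A : comPzRingType) (I : set A) : Prop :=
  [/\ I 0, (forall x y, I x -> I y -> I (x + y))
    & (forall a x, I x -> I (a * x))].

Definition is_derivation (k A : comPzRingType) (phi : {rmorphism k -> A})
    (f : A -> A) : Prop :=
  klinear phi f /\ (forall x y, f (x * y) = x * f y + f x * y).

(* The components D_0, ..., D_m of a sequence of length m are indexed by
   'I_m.+1; the component D_n is written D (inord n), which is meaningful
   only for n <= m. *)
Definition HS (k A : comPzRingType) (phi : {rmorphism k -> A}) (m : nat) :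
    set ('I_m.+1 -> A -> A) :=
  [set D | [/\ forall i, klinear phi (D i),
               D ord0 = id
             & forall (n : 'I_m.+1) (x y : A),
                 D n (x * y) =
                 \sum_(ij : 'I_m.+1 * 'I_m.+1 | (ij.1 + ij.2 == n)%N)
                   D ij.1 x * D ij.2 y]].

Definition nonzero_at (A : comPzRingType) (m : nat) (D : 'I_m.+1 -> A -> A) :
    pred nat :=
  fun h => (1 <= h <= m)%N && `[< D (inord h) <> (fun=> 0) >].

(* ell D = min {h >= 1 : D_h <> 0}, with None standing for infinity: for D in
   HS, no such h exists exactly when D is the identity. *)
Definition ell (A : comPzRingType) (m : nat) (D : 'I_m.+1 -> A -> A) :
    option nat :=
  match pselect (exists h, nonzero_at D h) with
  | left exD => Some (ex_minn exD)
  | right _ => None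
  end.

Definition leq_inf (e : nat) (l : option nat) : bool :=
  if l is Some h then (e <= h)%N else true.

Definition logarithmic (A : comPzRingType) (I : set A) (H : A -> A) : Prop :=
  H @` I `<=` I.

Definition HSlog (k A : comPzRingType) (phi : {rmorphism k -> A}) (I : set A)
    (m : nat) : set ('I_m.+1 -> A -> A) :=
  [set D | HS phi D /\ forall i, logarithmic I (D i)].

Definition r_logarithmic (A : comPzRingType) (I : set A) (r m : nat)
    (D : 'I_m.+1 -> A -> A) : Prop :=
  forall i : 'I_m.+1, (i <= r)%N -> logarithmic I (D i).

Definition IDer_log (k A : comPzRingType) (phi : {rmorphism k -> A})
    (I : set A) (n : nat) : set (A -> A) :=
  [set delta | is_derivation phi delta /\
     exists2 D : 'I_n.+1 -> A -> A, HSlog phi I D & D (inord 1) = delta].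

Definition condH (k A : comPzRingType) (phi : {rmorphism k -> A})
    (I : set A) (p a : nat) : Prop :=
  forall M : nat, (1 < M < p ^ a)%N -> ~ (exists j : nat, M = (p ^ j)%N) ->
    IDer_log phi I M.-1 = IDer_log phi I M.

(* Differential operators in Grothendieck's sense: H has order <= 0 if it is
   A-linear, and order <= n + 1 if all commutators [H, a] have order <= n. *)
Fixpoint diffop_le (A : comPzRingType) (n : nat) (H : A -> A) : Prop :=
  if n is n'.+1
  then forall a : A, diffop_le n' (fun x => H (a * x) - a * H x)
  else forall a x : A, H (a * x) = a * H x.

Definition is_diffop (k A : comPzRingType) (phi : {rmorphism k -> A})
    (H : A -> A) : Prop :=
  klinear phi H /\ exists n : nat, diffop_le n H.

(* Main.v *)
Require Import Defs.
From HB Require Import structures.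
From mathcomp Require Import all_boot all_order all_algebra.
From mathcomp Require Import boolp classical_sets.
From mathcomp Require Import zify.
Import GRing.Theory.
Local Open Scope classical_set_scope.
Local Open Scope ring_scope.

(** Think of a Hasse-Schmidt derivation D of length m as the k-linear series
    D_0 + D_1 t + ... + D_m t^m; these form a group under composition
    ([hcomp]), in which logarithmic derivations are a subgroup, and the
    substitution t -> t^e ([dilate]) turns a derivation of length m into one of
    length e (m + 1) - 1, with components only in degrees divisible by e. Put
    N = e p^s. If D had no component in degrees not divisible by e, then
    D'_i = D_(e i) would be the answer. The proof reduces to that case by
    composing D on the right with fully logarithmic derivations of length N;
    this changes D_N only by a logarithmic operator, since the components of D
    below degree N are logarithmic.

    The reduction ([sweep]) treats the degrees n = e, e + 1, ..., N - 1 in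
    turn. It keeps a modification W of D, and a logarithmic G of length p^s - 1
    such that W and G(t^e) agree in degrees below n. Then U = G(t^e)^(-1) W,
    taken up to degree N - 1, is logarithmic and vanishes in degrees
    1, ..., n - 1, and its component U_n = W_n - G(t^e)_n is a derivation.
    Choose r with n p^r < N <= n p^(r+1), so that r < s. By induction on s, the
    theorem applied to U up to degree n p^r gives a logarithmic integral of U_n
    of length p^r, and the hypothesis [condH] prolongs it to a logarithmic
    integral E of length p^(r+1) - 1 ([leading_term_integrable]).

    If e does not divide n, then n p^(r+1) <> N, because n p^(r+1) = e p^s would
    give n = e p^(s-r-1). Hence n p^(r+1) > N, so E(t^n) exists up to degree N,
    and composing W with its inverse kills the component W_n. If n = e q, then
    E(t^n) need not reach degree N, but q p^(r+1) >= p^s, so E(t^q) reaches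
    degree p^s - 1; G is replaced by E(t^q) G, and W is left alone. Thus the
    only factors which are obstructed in degree N are series in t^e, and these
    are kept. At n = N the degrees of W that are not divisible by e are zero,
    and D'_i = W_(e i) ([contraction]). *)

(** * Convolution sums *)

Section Convolution.
Set Implicit Arguments.
Unset Strict Implicit.
Variable V : zmodType.
Implicit Types (f g : nat -> nat -> V) (n : nat).

Definition conv n f : V := \sum_(i < n.+1) f i (n - i)%N.

Lemma eq_conv n f g :
  (forall i j, (i + j)%N = n -> f i j = g i j) -> conv n f = conv n g.
Proof.
by move=> fg; apply: eq_bigr => i _; apply: fg; rewrite subnKC // -ltnS.
Qed.

Lemma conv_eq0 n f : (forall i j, (i + j)%N = n -> f i j = 0) -> conv n f = 0.
Proof.
by move=> f0; apply: big1 => i _; apply: f0; rewrite subnKC // -ltnS.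
Qed.

Lemma conv0 f : conv 0 f = f 0 0.
Proof. by rewrite /conv big_ord1. Qed.

Lemma conv_recl n f : conv n.+1 f = f 0 n.+1 + conv n (fun i => f i.+1).
Proof. by rewrite /conv big_ord_recl subn0. Qed.

Lemma conv_recr n f : conv n.+1 f = conv n (fun i j => f i j.+1) + f n.+1 0.
Proof.
rewrite /conv big_ord_recr /= subnn; congr (_ + _).
by apply: eq_bigr => i _; rewrite subSn // -ltnS.
Qed.

Lemma conv_ends n f : (0 < n)%N ->
  (forall i j, (i + j)%N = n -> (0 < i)%N -> (0 < j)%N -> f i j = 0) ->
  conv n f = f 0 n + f n 0.
Proof.
case: n => // n _ f0; rewrite conv_recl; congr (_ + _).
case: n f0 => [|n] f0; first by rewrite conv0.
rewrite conv_recr conv_eq0 ?add0r // => i j ij.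
by apply: f0 => //; lia.
Qed.

Lemma convC n f : conv n f = conv n (fun i j => f j i).
Proof.
rewrite /conv (reindex_inj rev_ord_inj) /=.
by apply: eq_bigr => i _; rewrite subSS subKn // -ltnS.
Qed.

Lemma convD n f g : conv n (fun i j => f i j + g i j) = conv n f + conv n g.
Proof. by rewrite /conv big_split. Qed.

Lemma convA n (f : nat -> nat -> nat -> V) :
  conv n (fun i j => conv i (fun c d => f c d j)) =
  conv n (fun c l => conv l (fun d j => f c d j)).
Proof.
elim: n f => [|n IHn] f; first by rewrite !conv0.
rewrite conv_recl [RHS]conv_recl.
rewrite conv0.
rewrite [conv n.+1 (f 0)]conv_recl -addrA; congr (_ + _).
rewrite -IHn -convD; apply: eq_conv => i j _.
by rewrite conv_recl.
Qed.

(** This is the interchange (fg)(f'g') = (ff')(gg') in a commutative ring of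
    power series; it makes composition compatible with the Leibniz rule. *)
Lemma conv_swap n (f : nat -> nat -> nat -> nat -> V) :
  conv n (fun i j => conv i (fun c d => conv j (fun a b => f c d a b))) =
  conv n (fun u v => conv u (fun c a => conv v (fun d b => f c d a b))).
Proof.
rewrite (convA n (fun c d j => conv j (fun a b => f c d a b))).
rewrite (convA n (fun c a v => conv v (fun d b => f c d a b))).
apply: eq_conv => c l _.
rewrite -(convA l (fun d a b => f c d a b)).
rewrite -(convA l (fun a d b => f c d a b)).
by apply: eq_conv => v b _; rewrite convC.
Qed.

Lemma sum_dvd_support e q (F : nat -> V) : (0 < e)%N ->
  (forall i, (i <= e * q)%N -> ~~ (e %| i)%N -> F i = 0) ->
  \sum_(0 <= i < (e * q).+1) F i = \sum_(0 <= j < q.+1) F (e * j)%N.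
Proof.
move=> e0; elim: q => [|q IHq] F0; first by rewrite muln0 !big_nat1 muln0.
rewrite [RHS]big_nat_recr //= -IHq; last by move=> i ile; apply: F0; lia.
rewrite [LHS]big_nat_recr //= (big_cat_nat (n := (e * q).+1)) //=; last by lia.
rewrite [X in _ + X + _]big1_seq ?addr0 // => i.
rewrite mem_index_iota => /andP[_ /andP[il iu]].
apply: F0; first by lia.
apply/negP=> /dvdnP[c ic]; move: il iu.
by rewrite ic [(c * e)%N]mulnC ltn_pmul2l // ltn_pmul2l //; lia.
Qed.

(** A convolution supported in degrees divisible by e is one in the variable
    t^e. *)
Lemma conv_dvd_support e q f : (0 < e)%N ->
  (forall i j, (i + j)%N = (e * q)%N -> ~~ (e %| i)%N -> f i j = 0) ->
  conv (e * q) f = conv q (fun i j => f (e * i)%N (e * j)%N).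
Proof.
move=> e0 f0; rewrite /conv.
rewrite -(big_mkord xpredT (fun i => f i (e * q - i)%N)) sum_dvd_support //.
  by rewrite big_mkord; apply: eq_bigr => j _; rewrite mulnBr.
by move=> i ile; apply: f0; rewrite subnKC.
Qed.
End Convolution.

(** * The group of Hasse-Schmidt derivations *)

Section Hasse.
Set Implicit Arguments.
Unset Strict Implicit.
Variables (k A : comPzRingType) (phi : {rmorphism k -> A}).
Implicit Types (D E F W : nat -> A -> A) (f : A -> A) (m n e : nat).

Lemma klin0 f : klinear phi f -> f 0 = 0.
Proof. by case=> fD _; apply: (addrI (f 0)); rewrite -fD !addr0. Qed.

Lemma klin_conv f n (g : nat -> nat -> A) :
  klinear phi f -> f (conv n g) = conv n (fun i j => f (g i j)).
Proof. by move=> kf; exact: (big_morph f (proj1 kf) (klin0 kf)). Qed.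

Lemma klinear0 : klinear phi (fun=> 0).
Proof. by split=> [x y|c x]; rewrite ?addr0 ?mulr0. Qed.

Lemma klinear_id : klinear phi id.
Proof. by []. Qed.

Lemma klinear_comp f g : klinear phi f -> klinear phi g -> klinear phi (f \o g).
Proof.
move=> [fD fZ] [gD gZ]; split=> [x y|c x] /=; first by rewrite gD fD.
by rewrite gZ fZ.
Qed.

Lemma klinearB f g : klinear phi f -> klinear phi g ->
  klinear phi (fun x => f x - g x).
Proof.
move=> [fD fZ] [gD gZ]; split=> [x y|c x]; first by rewrite fD gD opprD addrACA.
by rewrite fZ gZ mulrBr.
Qed.

Lemma klinear_sum n (f : 'I_n -> A -> A) :
  (forall i, klinear phi (f i)) -> klinear phi (fun x => \sum_(i < n) f i x).
Proof.
move=> kf; split=> [x y|c x].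
  by rewrite -big_split; apply: eq_bigr => i _; rewrite (proj1 (kf i)).
by rewrite mulr_sumr; apply: eq_bigr => i _; rewrite (proj2 (kf i)).
Qed.

Lemma eq_klinear f g : f =1 g -> klinear phi f -> klinear phi g.
Proof. by move=> fg [fD fZ]; split=> [x y|c x]; rewrite -!fg ?fD ?fZ. Qed.

(** Components are indexed by all of nat, and only those up to m are
    constrained: truncation is then the identity, and composition needs no
    bound on indices. *)
Definition hasse m D : Prop :=
  [/\ forall i, (i <= m)%N -> klinear phi (D i), D 0 =1 id
    & forall n x y, (n <= m)%N ->
        D n (x * y) = conv n (fun i j => D i x * D j y)].

Lemma hasse_le m n D : (n <= m)%N -> hasse m D -> hasse n D.
Proof.
move=> nm [kD D0 DM]; split=> // [i ile|i x y ile].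
  by apply: kD; apply: leq_trans nm.
by apply: DM; apply: leq_trans nm.
Qed.

Lemma hasse_id m : hasse m (fun i => if i is 0 then id else fun=> 0).
Proof.
split=> [[|i] _|//|[|n] x y _]; [exact: klinear_id|exact: klinear0| |].
  by rewrite conv0.
by rewrite conv_eq0 // => -[|i] [|j] // _; rewrite ?mulr0 ?mul0r.
Qed.

Definition hcomp D E n x : A := conv n (fun i j => D i (E j x)).

Lemma hcomp_klinear m D E :
  (forall i, (i <= m)%N -> klinear phi (D i)) ->
  (forall i, (i <= m)%N -> klinear phi (E i)) ->
  forall i, (i <= m)%N -> klinear phi (hcomp D E i).
Proof.
move=> kD kE i im; apply: klinear_sum => j.
have ji := ltn_ord j.
by apply: (@klinear_comp (D j) (E (i - j)%N)); [apply: kD|apply: kE]; lia.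
Qed.

Lemma mul_hcomp D E n x y :
  conv n (fun i j => conv i (fun c d => conv j (fun a b =>
    D c (E a x) * D d (E b y)))) =
  conv n (fun i j => hcomp D E i x * hcomp D E j y).
Proof.
rewrite conv_swap; apply: eq_conv => i j _.
by rewrite /hcomp /conv big_distrlr.
Qed.

Lemma hasse_comp_mul m m' D E i j x y : hasse m D -> hasse m' E ->
  (i <= m)%N -> (j <= m')%N ->
  D i (E j (x * y)) =
  conv i (fun c d => conv j (fun a b => D c (E a x) * D d (E b y))).
Proof.
move=> [kD _ DM] [_ _ EM] im jm; rewrite EM // (klin_conv _ _ (kD i im)).
rewrite [LHS](eq_conv (g := fun a b =>
    conv i (fun c d => D c (E a x) * D d (E b y)))).
  by rewrite /conv exchange_big.
by move=> a b ab; rewrite DM.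
Qed.

Lemma hasse_comp m D E : hasse m D -> hasse m E -> hasse m (hcomp D E).
Proof.
move=> hD hE; have [kD D0 _] := hD; have [kE E0 _] := hE; split.
- exact: hcomp_klinear.
- by move=> x; rewrite /hcomp conv0 E0 D0.
- move=> n x y nm; rewrite -mul_hcomp; apply: eq_conv => i j ij.
  by apply: hasse_comp_mul hD hE _ _; lia.
Qed.

(** The equation in degree n determines F n from the lower components, because
    E 0 is the identity. *)
Lemma left_inverse_exists m E : E 0 =1 id -> exists F, F 0 =1 id /\
  forall n x, (0 < n <= m)%N -> hcomp F E n x = 0.
Proof.
move=> E0; elim: m => [|m [F [F0 FE]]].
  by exists (fun=> id); split=> // n x; case: n.
exists (fun i => if (i <= m)%N then F i else
  fun x => - conv m (fun i j => F i (E j.+1 x))); split=> // n x /andP[n0 nm].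
have [{}nm|mn] := leqP n m.
  rewrite -[RHS](FE n x); last by rewrite n0.
  by apply: eq_conv => i j ij; rewrite ifT //; lia.
have -> : n = m.+1 by lia.
rewrite /hcomp conv_recr ltnn E0.
rewrite (eq_conv (g := fun i j => F i (E j.+1 x))) ?addrN //.
by move=> i j ij; rewrite ifT //; lia.
Qed.

Lemma hcomp_recr D E n x : E 0 =1 id -> hcomp D E n.+1 x = 0 ->
  D n.+1 x = - conv n (fun i j => D i (E j.+1 x)).
Proof.
move=> E0; rewrite /hcomp conv_recr E0 => /eqP.
by rewrite addrC addr_eq0 => /eqP.
Qed.

(** In F m.+1 (x * y), the recursion for F and the Leibniz rules in lower degree
    yield all terms of the convolution of (F E) x and (F E) y except those with
    E 0 on both sides, which form the desired right-hand side; and the whole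
    convolution is zero, as F E is the identity. *)
Lemma hasse_left_inverse m E F : hasse m E -> F 0 =1 id ->
  (forall n x, (0 < n <= m)%N -> hcomp F E n x = 0) -> hasse m F.
Proof.
move=> hE F0 FE; have [kE E0 EM] := hE.
elim: m hE FE kE EM => [|m IHm] hE FE kE EM.
  split=> //.
    by move=> i; rewrite leqn0 => /eqP->; apply: eq_klinear klinear_id => x.
  by move=> n x y; rewrite leqn0 => /eqP->; rewrite conv0 !F0.
have hF : hasse m F.
  apply: IHm.
  - exact: hasse_le hE.
  - by move=> n x nm; apply: FE; lia.
  - by move=> i im; apply: kE; lia.
  - by move=> n x y im; apply: EM; lia.
have [kF _ FM] := hF.
have Frec x : F m.+1 x = - conv m (fun i j => F i (E j.+1 x)).
  by apply: (@hcomp_recr F E m x E0); apply: FE; lia.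
have kFm : klinear phi (F m.+1).
  apply: (@eq_klinear (fun x => 0 - conv m (fun i j => F i (E j.+1 x)))).
    by move=> x; rewrite Frec sub0r.
  apply: klinearB; first exact: klinear0.
  apply: klinear_sum => i; have := ltn_ord i => im.
  by apply: (@klinear_comp (F i) (E _)); [apply: kF|apply: kE]; lia.
split=> // [i|n x y].
  by rewrite leq_eqVlt => /orP[/eqP->//|]; apply: kF.
rewrite leq_eqVlt => /orP[/eqP->|]; last by apply: FM.
have : conv m.+1 (fun i j => hcomp F E i x * hcomp F E j y) = 0.
  rewrite conv_eq0 // => -[|i] j ij.
    by rewrite (FE j y) ?mulr0 //; lia.
  by rewrite (FE i.+1 x) ?mul0r //; lia.
rewrite -mul_hcomp conv_recr.
rewrite (eq_conv (g := fun i j => F i (E j.+1 (x * y)))); last first.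
  by move=> i j ij; rewrite (hasse_comp_mul _ _ hF hE) //; lia.
rewrite Frec => /eqP; rewrite addrC addr_eq0 => /eqP <-.
by apply: eq_conv => i j _; rewrite conv0 !E0.
Qed.

Lemma hasse_left_inverseP m E : hasse m E -> exists F,
  hasse m F /\ forall n x, (0 < n <= m)%N -> hcomp F E n x = 0.
Proof.
move=> hE; have [_ E0 _] := hE.
have [F [F0 FE]] := left_inverse_exists m E0.
by exists F; split=> //; apply: hasse_left_inverse FE.
Qed.

(** The substitution t -> t^e. *)
Definition dilate e D i : A -> A :=
  if (e %| i)%N then D (i %/ e)%N else fun=> 0.

Lemma dilateM e D i : (0 < e)%N -> dilate e D (e * i) = D i.
Proof. by move=> e0; rewrite /dilate dvdn_mulr // mulKn. Qed.

Lemma dilate_self e D : (0 < e)%N -> dilate e D e = D 1%N.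
Proof. by move=> e0; rewrite -{2}(muln1 e) dilateM. Qed.

Lemma dilate_ndvd e D i : ~~ (e %| i)%N -> dilate e D i = fun=> 0.
Proof. by rewrite /dilate => /negbTE->. Qed.

Lemma dilate_lt e D i : (0 < i < e)%N -> dilate e D i = fun=> 0.
Proof. by move=> /andP[i0 ie]; rewrite dilate_ndvd // gtnNdvd. Qed.

(** Degrees strictly between e * m and e * m.+1 carry no component, so the
    length e * m.+1 - 1 is reached without prolonging D. This gain is what lets
    a derivation of length p^s - 1 act in all degrees below e p^s. *)
Lemma hasse_dilate m n e D :
  (n < e * m.+1)%N -> hasse m D -> hasse n (dilate e D).
Proof.
move=> nem [kD D0 DM]; have e0 : (0 < e)%N by case: (e) nem.
have le_m q : (e * q <= n)%N -> (q <= m)%N.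
  by move=> eq; rewrite -ltnS -(ltn_pmul2l e0); apply: leq_ltn_trans nem.
split=> [i im||i x y im].
- have [/dvdnP[q iq]|/dilate_ndvd->] := boolP (e %| i)%N; last exact: klinear0.
  by move: im; rewrite iq mulnC dilateM // => /le_m; apply: kD.
- by move=> x; rewrite /dilate dvdn0 div0n D0.
have [/dvdnP[q iq]|ei] := boolP (e %| i)%N.
  move: im; rewrite iq [(q * e)%N]mulnC dilateM // => /le_m qm.
  rewrite DM // conv_dvd_support //.
    by apply: eq_conv => a b _; rewrite !dilateM.
  by move=> a b _ ea; rewrite dilate_ndvd // mul0r.
rewrite dilate_ndvd //.
rewrite conv_eq0 // => a b ab.
have [ea|ea] := boolP (e %| a)%N; last by rewrite dilate_ndvd // mul0r.
rewrite (@dilate_ndvd e D b) ?mulr0 //.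
by apply: contra ei => eb; rewrite -ab dvdn_add.
Qed.

Lemma hasse_contract m n e D : (0 < e)%N -> (e * m <= n)%N -> hasse n D ->
  (forall i x, (i <= n)%N -> ~~ (e %| i)%N -> D i x = 0) ->
  hasse m (fun i => D (e * i)%N).
Proof.
move=> e0 emn [kD D0 DM] De.
have le_em i : (i <= m)%N -> (e * i <= n)%N.
  by move=> im; apply: leq_trans emn; rewrite leq_mul2l im orbT.
split=> [i im||i x y im]; first by apply: kD; apply: le_em.
  by rewrite muln0.
rewrite DM ?le_em // conv_dvd_support // => a b ab ea; rewrite De ?mul0r //.
by have := le_em _ im; lia.
Qed.

(** The mixed terms vanish in particular for the lowest nonzero component. *)
Lemma hasse_derivation m n D : (0 < n <= m)%N -> hasse m D ->
  (forall i j x y, (i + j)%N = n -> (0 < i)%N -> (0 < j)%N ->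
     D i x * D j y = 0) -> is_derivation phi (D n).
Proof.
move=> /andP[n0 nm] [kD D0 DM] Dn; split; first exact: kD.
move=> x y; rewrite DM // conv_ends // ?D0 //.
by move=> i j; apply: Dn.
Qed.

(** * Passage between the two indexings *)

Lemma sum_pair_conv m (n : 'I_m.+1) (g : nat -> nat -> A) :
  \sum_(ij : 'I_m.+1 * 'I_m.+1 | (ij.1 + ij.2 == n)%N) g ij.1 ij.2 = conv n g.
Proof.
rewrite -(pair_big_dep xpredT (fun i j : 'I_m.+1 => (i + j == n)%N)
  (fun i j => g i j)) /=.
rewrite /conv (big_ord_widen m.+1 (fun i => g i (n - i)%N)) //.
rewrite [RHS]big_mkcond; apply: eq_bigr => i _.
case: ifP => [ilen|/negbT ilen]; last first.
  by rewrite big_pred0 // => j; apply/negbTE; move: ilen; lia.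
have nim : (n - i < m.+1)%N by have := ltn_ord n; lia.
rewrite (big_pred1 (Ordinal nim)) // => j.
by apply/idP/eqP => [/eqP ijn|->] /=; [apply: val_inj => /=|]; lia.
Qed.

Lemma HS_hasse m (D : 'I_m.+1 -> A -> A) :
  HS phi D -> hasse m (fun i => D (inord i)).
Proof.
move=> [kD D0 DM]; split=> [i _||n x y nm]; first exact: kD.
  move=> x; rewrite (_ : inord 0 = ord0) ?D0 //.
  by apply: val_inj; rewrite /= inordK.
rewrite DM -[in RHS](@inordK m n) // -sum_pair_conv.
by apply: eq_bigr => ij _; rewrite !inord_val.
Qed.

Lemma hasse_HS m D : hasse m D -> HS phi (fun i : 'I_m.+1 => D i).
Proof.
move=> [kD D0 DM]; split=> [i||n x y]; first by apply: kD; rewrite -ltnS.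
  exact: funext.
rewrite DM; last by rewrite -ltnS.
by rewrite -sum_pair_conv.
Qed.

(** * Components are differential operators *)

Lemma eq_diffop n f g : f =1 g -> diffop_le n f -> diffop_le n g.
Proof. by move=> /funext->. Qed.

Lemma diffop_le_zero n : diffop_le n (fun=> 0 : A).
Proof.
elim: n => [|n IHn] /= a; first by move=> x; rewrite mulr0.
by apply: eq_diffop IHn => x; rewrite mulr0 subr0.
Qed.

Lemma diffop_leS n f : diffop_le n f -> diffop_le n.+1 f.
Proof.
elim: n f => [|n IHn] f /= fn a; last exact/IHn/fn.
by move=> b x; rewrite !fn !subrr mulr0.
Qed.

Lemma diffop_le_leq m n f : (m <= n)%N -> diffop_le m f -> diffop_le n f.
Proof.
move=> mn fm; rewrite -(subnK mn).
by elim: (n - m)%N => // l IHl; apply: diffop_leS.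
Qed.

Lemma diffop_leD n f g : diffop_le n f -> diffop_le n g ->
  diffop_le n (fun x => f x + g x).
Proof.
elim: n f g => [|n IHn] f g /= fn gn a; first by move=> x; rewrite fn gn mulrDr.
apply: eq_diffop (IHn _ _ (fn a) (gn a)) => x.
by rewrite mulrDr opprD addrACA.
Qed.

Lemma diffop_leZ n b f : diffop_le n f -> diffop_le n (fun x => b * f x).
Proof.
elim: n f => [|n IHn] f /= fn a; first by move=> x; rewrite fn mulrCA.
apply: eq_diffop (IHn _ (fn a)) => x.
by rewrite mulrBr [a * (b * _)]mulrCA.
Qed.

Lemma diffop_le_sum n m (f : 'I_m -> A -> A) :
  (forall i, diffop_le n (f i)) -> diffop_le n (fun x => \sum_(i < m) f i x).
Proof.
elim: m f => [|m IHm] f fn.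
  by apply: eq_diffop (diffop_le_zero n) => x; rewrite big_ord0.
apply: (eq_diffop (f := fun x => f ord0 x + \sum_(i < m) f (lift ord0 i) x)).
  by move=> x; rewrite big_ord_recl.
by apply: diffop_leD => //; apply: IHm.
Qed.

Lemma hasse_diffop m n D : hasse m D -> (n <= m)%N -> diffop_le n (D n).
Proof.
move=> [kD D0 DM]; elim/ltn_ind: n => -[|n] IHn nm.
  by move=> a x; rewrite !D0.
(* The term D 0 a * D n.+1 x of the Leibniz rule cancels in [D n.+1, a], so
   the commutator is a combination of the D i with i <= n. *)
move=> a; apply: (eq_diffop
  (f := fun x => \sum_(i < n.+1) D i.+1 a * D (n - i)%N x)).
  by move=> x; rewrite DM // conv_recl D0 addrC addKr.
apply: diffop_le_sum => i; apply: diffop_leZ.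
by apply: (@diffop_le_leq (n - i)%N); [exact: leq_subr|apply: IHn; lia].
Qed.

End Hasse.

(** * Logarithmic Hasse-Schmidt derivations *)

Section Logarithmic.
Set Implicit Arguments.
Unset Strict Implicit.
Variables (k A : comPzRingType) (phi : {rmorphism k -> A}) (I : set A).
Hypothesis idealI : is_ideal I.
Implicit Types (D E F W : nat -> A -> A) (f : A -> A) (m n e : nat).

Let I0 : I 0. Proof. by case: idealI. Qed.
Let ID x y : I x -> I y -> I (x + y).
Proof. by case: idealI => _ + _; apply. Qed.
Let IN x : I x -> I (- x).
Proof. by case: idealI => _ _ IM Ix; rewrite -mulN1r; apply: IM. Qed.
Lemma ideal_conv n (g : nat -> nat -> A) :
  (forall i j, (i + j)%N = n -> I (g i j)) -> I (conv n g).
Proof.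
move=> Ig; apply: (big_ind I) => // i _; apply: Ig.
by rewrite subnKC // -ltnS.
Qed.

Definition log_upto m D : Prop := forall i x, (i <= m)%N -> I x -> I (D i x).

Lemma log_upto_le m n D : (n <= m)%N -> log_upto m D -> log_upto n D.
Proof. by move=> nm lD i x im; apply: lD; apply: leq_trans nm. Qed.

Lemma log_upto_id m : log_upto m (fun i => if i is 0 then id else fun=> 0).
Proof. by move=> [|i] x. Qed.

Lemma log_upto_comp m D E :
  log_upto m D -> log_upto m E -> log_upto m (hcomp D E).
Proof.
move=> lD lE n x nm Ix; apply: ideal_conv => i j ij.
by apply: lD; [lia|apply: lE => //; lia].
Qed.

Lemma log_upto_left_inverse m E F : E 0 =1 id -> F 0 =1 id ->
  (forall n x, (0 < n <= m)%N -> hcomp F E n x = 0) ->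
  log_upto m E -> log_upto m F.
Proof.
move=> E0 F0 FE lE i; elim/ltn_ind: i => -[|i] IHi x im Ix; first by rewrite F0.
rewrite (hcomp_recr E0); last exact: FE.
apply/IN/ideal_conv => a b ab; apply: IHi; try lia.
by apply: lE => //; lia.
Qed.

Lemma log_upto_dilate m n e D : (n < e * m.+1)%N -> log_upto m D ->
  log_upto n (dilate e D).
Proof.
move=> nem lD i x im Ix; have e0 : (0 < e)%N by case: (e) nem.
have [/dvdnP[q iq]|/dilate_ndvd->] := boolP (e %| i)%N; last exact: I0.
move: im; rewrite iq mulnC dilateM // => im; apply: lD => //.
by rewrite -ltnS -(ltn_pmul2l e0); apply: leq_ltn_trans nem.
Qed.

Lemma hasse_log_left_inverse m E : hasse phi m E -> log_upto m E ->
  exists F, [/\ hasse phi m F, log_upto m F &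
    forall n x, (0 < n <= m)%N -> hcomp F E n x = 0].
Proof.
move=> hE lE; have [F [hF FE]] := hasse_left_inverseP hE.
exists F; split=> //; have [_ E0 _] := hE; have [_ F0 _] := hF.
exact: log_upto_left_inverse E0 F0 FE lE.
Qed.

Lemma left_inverse_low m n E F : (0 < n <= m)%N -> hasse phi m E -> F 0 =1 id ->
  (forall i x, (0 < i <= m)%N -> hcomp F E i x = 0) ->
  (forall i x, (0 < i < n)%N -> E i x = 0) ->
  (forall i x, (0 < i < n)%N -> F i x = 0) /\ (forall x, F n x = - E n x).
Proof.
move=> /andP[n0 nm] [kE E0 _] F0 FE En.
have Fn i x : (i < n)%N -> (0 < i)%N -> F i x = 0.
  elim/ltn_ind: i x => -[//|i] IHi x lin _.
  rewrite (hcomp_recr E0); last by apply: FE; lia.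
  rewrite conv_eq0 ?oppr0 // => -[|a] b ab; last by apply: IHi; lia.
  by rewrite F0; apply: En; lia.
split=> [i x /andP[i0 lin]|x]; first exact: Fn.
case: n n0 nm En Fn => [//|n] _ nm En Fn.
rewrite (hcomp_recr E0); last by apply: FE; lia.
case: n nm En Fn => [|n] nm En Fn; first by rewrite conv0 F0.
rewrite conv_recl F0 conv_eq0 ?addr0 // => i j ij.
by apply: Fn; lia.
Qed.

(** For n > 0 this is membership in [IDer_log], by [IDer_logE]. *)
Definition log_integrable n f : Prop :=
  exists E, [/\ hasse phi n E, log_upto n E & E 1 =1 f].

Lemma IDer_logE n f : (0 < n)%N -> IDer_log phi I n f <-> log_integrable n f.
Proof.
move=> n0; split=> [[_ [D [hD lD] <-]]|[E [hE lE /funext E1]]].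
  exists (fun i => D (inord i)); split=> //; first exact: HS_hasse.
  by move=> i x _ Ix; apply: lD; exists x.
split; last first.
  exists (fun i : 'I_n.+1 => E i); last by rewrite inordK // ltnS.
  split; first exact: hasse_HS.
  by move=> i _ [x Ix <-]; apply: lE => //; rewrite -ltnS.
by rewrite -E1; apply: hasse_derivation hE _ => // -[|i] [|j] //; lia.
Qed.
End Logarithmic.

(** * Contraction of D to length p^s *)

Section Contraction.
Set Implicit Arguments.
Unset Strict Implicit.
Variables (k A : comPzRingType) (phi : {rmorphism k -> A}) (I : set A).
Hypothesis idealI : is_ideal I.
Implicit Types (D E F G U W : nat -> A -> A) (f : A -> A) (m n e q r s : nat).

Lemma hcomp_lowr m n D E : (0 < n <= m)%N -> hasse phi m D -> hasse phi m E ->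
  (forall i x, (0 < i < n)%N -> E i x = 0) ->
  (forall i x, (i < n)%N -> hcomp D E i x = D i x) /\
  (forall x, hcomp D E n x = D n x + E n x).
Proof.
move=> /andP[n0 nm] [kD D0 _] [_ E0 _] En.
have Dends i x : (0 < i <= n)%N -> hcomp D E i x = D i x + E i x.
  move=> /andP[i0 ilen].
  rewrite /hcomp conv_ends // ?E0 ?D0 1?addrC // => u v uv u0 v0.
  by rewrite En ?(klin0 (kD u _)) //; lia.
split=> [[|i] x ilt|x]; last by apply: Dends; rewrite n0 /=.
  by rewrite /hcomp conv0 E0.
by rewrite Dends ?En ?addr0 //; lia.
Qed.

Lemma hcomp_lowl m n D E : (0 < n <= m)%N -> hasse phi m D -> hasse phi m E ->
  (forall i x, (0 < i < n)%N -> D i x = 0) ->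
  (forall i x, (i < n)%N -> hcomp D E i x = E i x) /\
  (forall x, hcomp D E n x = E n x + D n x).
Proof.
move=> /andP[n0 nm] [_ D0 _] [_ E0 _] Dn.
have Dends i x : (0 < i <= n)%N -> hcomp D E i x = E i x + D i x.
  move=> /andP[i0 ilen]; rewrite /hcomp conv_ends // ?E0 ?D0 // => u v uv u0 v0.
  by rewrite Dn //; lia.
split=> [[|i] x ilt|x]; last by apply: Dends; rewrite n0 /=.
  by rewrite /hcomp conv0 D0.
by rewrite Dends ?Dn ?addr0 //; lia.
Qed.

Variables (p a : nat).
Hypotheses (p_gt1 : (1 < p)%N) (condHI : condH phi I p a).

(** Strictly between p^r and p^(r+1) there is no power of p, so [condH] applies
    to every length there. *)
Lemma log_integrable_climb r f :
  (r < a)%N -> log_integrable phi I (p ^ r) f ->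
  log_integrable phi I (p ^ r.+1).-1 f.
Proof.
move=> ra fr.
have pr0 j : (0 < p ^ j)%N by rewrite expn_gt0; lia.
suff climb M : (p ^ r <= M < p ^ r.+1)%N -> log_integrable phi I M f.
  have ltpr : (p ^ r < p ^ r.+1)%N by rewrite ltn_exp2l.
  by apply: climb; have := pr0 r.+1; lia.
elim: M => [|M IHM]; first by have := pr0 r; lia.
rewrite leq_eqVlt => /andP[/orP[/eqP<- //|rM] Mr].
have M0 : (0 < M)%N by have := pr0 r; lia.
apply/IDer_logE => //; rewrite -condHI.
- by apply/IDer_logE => //; apply: IHM; lia.
- rewrite ltnS M0 /=; apply: leq_trans Mr _.
  by rewrite leq_exp2l.
- move=> [j Mj]; move: rM Mr; rewrite -ltnS Mj.
  by rewrite ltnS ltn_exp2l // ltn_exp2l //; lia.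
Qed.

(** This is what the induction on s provides for the exponents r < s. *)
Definition leading_integrable r : Prop := forall n U, (0 < n)%N ->
  hasse phi (n * p ^ r) U -> log_upto I (n * p ^ r) U ->
  (forall i x, (0 < i < n)%N -> U i x = 0) ->
  log_integrable phi I (p ^ r) (U n).

(** Take r maximal with n p^r < e p^s. The integral of length p^r comes from the
    truncation of U, and [log_integrable_climb] extends its length up to the
    next obstruction. *)
Lemma leading_term_integrable s e n U : (s <= a)%N ->
  (forall r, (r < s)%N -> leading_integrable r) ->
  (0 < e <= n)%N -> (n < e * p ^ s)%N ->
  hasse phi (e * p ^ s).-1 U -> log_upto I (e * p ^ s).-1 U ->
  (forall i x, (0 < i < n)%N -> U i x = 0) ->
  exists r, [/\ (r < s)%N, (e * p ^ s <= n * p ^ r.+1)%N &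
    log_integrable phi I (p ^ r.+1).-1 (U n)].
Proof.
move=> sa lead /andP[e0 en] nN hU lU Un.
have exr : exists r, (e * p ^ s <= n * p ^ r)%N.
  by exists s; rewrite leq_mul2r en orbT.
case: (ex_minnP exr) => -[|r] rN rmin; first by move: rN; rewrite muln1; lia.
have rlt : (n * p ^ r < e * p ^ s)%N.
  by rewrite ltnNge; apply/negP => /rmin; rewrite ltnn.
have rs : (r < s)%N by apply: rmin; rewrite leq_mul2r en orbT.
exists r; split=> //; apply: log_integrable_climb; first by lia.
apply: lead => //; first by lia.
  by apply: hasse_le hU; lia.
by apply: log_upto_le lU; lia.
Qed.

(** The invariant of the reduction: W is D composed with logarithmic factors of
    order > e, and below degree n it is the series G in t^e. Of that
    composition, only its effect on the components e and N is recorded. *)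
Definition swept e N D W G n : Prop :=
  [/\ hasse phi N W, log_upto I N.-1 W,
      forall x, I x -> I (W N x - D N x), W e =1 D e
    & forall i x, (i < n)%N -> W i x = dilate e G i x].

(** Induction on n. At degree n, the difference between W and G(t^e) is a
    derivation with a logarithmic integral E; the correction E(t^n) is absorbed
    into G if e divides n, and removed from W otherwise. *)
Lemma sweep s e D : (s <= a)%N ->
  (forall r, (r < s)%N -> leading_integrable r) -> (0 < e)%N ->
  hasse phi (e * p ^ s) D -> log_upto I (e * p ^ s).-1 D ->
  (forall i x, (0 < i < e)%N -> D i x = 0) ->
  forall n, (e <= n <= e * p ^ s)%N -> exists W G,
    [/\ hasse phi (p ^ s).-1 G, log_upto I (p ^ s).-1 G &
        swept e (e * p ^ s) D W G n].
Proof.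
move=> sa lead e0 hD lD De; set N := (e * p ^ s)%N.
have ps0 : (0 < p ^ s)%N by rewrite expn_gt0; lia.
have I0 : I 0 by case: idealI.
have ID x y : I x -> I y -> I (x + y) by case: idealI => _ + _; apply.
elim=> [|n IHn]; first by lia.
rewrite leq_eqVlt => /andP[/orP[/eqP en|en] nN].
  exists D, (fun i => if i is 0 then id else fun=> 0).
  split; [exact: hasse_id|exact: log_upto_id|split=> //].
    by move=> x _; rewrite subrr.
  move=> [|i] x; rewrite -en => ie.
    by rewrite /dilate dvdn0 div0n; case: hD => _ ->.
  by rewrite De // dilate_lt.
have [|W [G [hG lG [hW lW WD We WG]]]] := IHn; first by lia.
have n0 : (0 < n)%N by lia.
have ltN1 : (N.-1 < e * (p ^ s).-1.+1)%N by rewrite !prednK //; lia.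
have hGe := hasse_dilate ltN1 hG; have lGe := log_upto_dilate idealI ltN1 lG.
(* U = G(t^e)^(-1) W isolates the part of W not accounted for by G. *)
have [F [hF lF FG]] := hasse_log_left_inverse idealI hGe lGe.
have F0 : F 0 =1 id by case: hF.
pose U := hcomp F W.
have hU : hasse phi N.-1 U.
  by apply: hasse_comp hF _; apply: hasse_le hW; lia.
have lU : log_upto I N.-1 U by apply: log_upto_comp.
have Ulow i x : (0 < i < n)%N -> U i x = 0.
  move=> iln; rewrite -[RHS](FG i x); last by lia.
  by apply: eq_conv => u v uv; rewrite WG //; lia.
have Un x : U n x = W n x - dilate e G n x.
  have := FG n x; rewrite /U /hcomp.
  case: n n0 nN WG {IHn en Ulow} => // n _ nN WG.
  rewrite !conv_recl !F0 => FG0.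
  rewrite -[LHS](subr0 _) -FG0; last by lia.
  rewrite opprD addrACA (eq_conv (g := fun i j => F i.+1 (dilate e G j x))).
    by rewrite subrr addr0.
  by move=> i j ij; rewrite WG //; lia.
have [||r [rs rN [E [hE lE E1]]]] :=
  leading_term_integrable sa lead _ _ hU lU Ulow.
- by rewrite e0.
- by lia.
have pr0 : (0 < p ^ r.+1)%N by rewrite expn_gt0; lia.
have [/dvdnP[q nq]|ndv] := boolP (e %| n)%N.
  (* n = e q: here n p^(r+1) may equal N, so E(t^n) is used only below N. *)
  rewrite mulnC in nq.
  have q0 : (0 < q)%N by lia.
  have qs : (q <= (p ^ s).-1)%N.
    by rewrite -ltnS prednK // -(ltn_pmul2l e0) -nq.
  have sr : ((p ^ s).-1 < q * (p ^ r.+1).-1.+1)%N.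
    rewrite prednK // -ltnS prednK // ltnS -(leq_pmul2l e0).
    by rewrite mulnA -nq.
  have hQ := hasse_dilate sr hE; have lQ := log_upto_dilate idealI sr lE.
  exists W, (hcomp (dilate q E) G).
  split; [exact: hasse_comp|exact: log_upto_comp|].
  have [||Gl Gq] := hcomp_lowl (n := q) _ hQ hG; first by rewrite q0.
    by move=> i x iq; rewrite dilate_lt.
  split=> // i x; rewrite ltnS leq_eqVlt => /orP[/eqP->|iltn].
    rewrite nq dilateM // Gq dilate_self // E1 Un.
    by rewrite nq dilateM // addrC subrK.
  rewrite WG //; have [/dvdnP[j ij]|ei] := boolP (e %| i)%N.
    rewrite ij mulnC !dilateM // Gl //.
    by rewrite -(ltn_pmul2l e0) -nq mulnC -ij.
  by rewrite !dilate_ndvd.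
(* Equality n p^(r+1) = e p^s would make e divide n. *)
have Nlt : (N < n * (p ^ r.+1).-1.+1)%N.
  rewrite prednK // ltn_neqAle rN andbT; apply: contra ndv => /eqP Neq.
  have : (n * p ^ r.+1 = e * p ^ (s - r.+1) * p ^ r.+1)%N.
    by rewrite -Neq -mulnA -expnD subnK.
  by move/eqP; rewrite eqn_pmul2r // => /eqP->; rewrite dvdn_mulr.
have hQ := hasse_dilate Nlt hE; have lQ := log_upto_dilate idealI Nlt lE.
have [P [hP lP PQ]] := hasse_log_left_inverse idealI hQ lQ.
have P0 : P 0 =1 id by case: hP.
have nN' : (0 < n <= N)%N by lia.
have [|Plow Pn] := left_inverse_low nN' hQ P0 PQ.
  by move=> i x il; rewrite dilate_lt.
have [Wl Wn] := hcomp_lowr nN' hW hP Plow.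
exists (hcomp W P), G; split=> //; split.
- exact: hasse_comp.
- by apply: log_upto_comp => //; apply: log_upto_le lP; lia.
- move=> x Ix; rewrite -(subrK (W N x) (hcomp W P N x)) -addrA.
  apply: ID; last exact: WD.
  have : (0 < N)%N by lia.
  move: lW lP; rewrite /hcomp; case: (N) => // N' lW lP _.
  rewrite conv_recr P0 addrK; apply: ideal_conv => // i j ij.
  by apply: lW => /=; [lia|apply: lP => //; lia].
- move=> x; rewrite Wl // ltn_neqAle; apply/andP; split; last by lia.
  by apply: contra ndv => /eqP->.
- move=> i x; rewrite ltnS leq_eqVlt => /orP[/eqP->|iltn].
    rewrite Wn Pn dilate_self // E1 Un dilate_ndvd //.
    by rewrite subr0 subrr.
  by rewrite Wl ?WG.
Qed.

(** Strong induction on s: for r < s and a derivation that is logarithmic in all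
    degrees, the conclusion gives an integral logarithmic in all degrees, which
    is [leading_integrable]. *)
Lemma contraction s e D : (s <= a)%N -> (0 < e)%N ->
  hasse phi (e * p ^ s) D -> log_upto I (e * p ^ s).-1 D ->
  (forall i x, (0 < i < e)%N -> D i x = 0) ->
  exists D', [/\ hasse phi (p ^ s) D', D' 1 =1 D e, log_upto I (p ^ s).-1 D' &
    forall x, I x -> I (D' (p ^ s)%N x - D (e * p ^ s)%N x)].
Proof.
elim/ltn_ind: s e D => s IHs e D sa e0 hD lD De.
have ps0 j : (0 < p ^ j)%N by rewrite expn_gt0; lia.
have lead r : (r < s)%N -> leading_integrable r.
  move=> rs n U n0 hU lU Un.
  have [||D' [hD' D'1 lD' D'r]] := IHs r rs n U _ n0 hU _ Un.
  - by lia.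
  - by apply: log_upto_le lU; lia.
  exists D'; split=> // i x; rewrite leq_eqVlt => /orP[/eqP->|ir] Ix.
    rewrite -[D' _ x](subrK (U (n * p ^ r)%N x)).
    have [_ ID _] := idealI; apply: ID; [exact: D'r|exact: lU].
  by apply: lD' => //; lia.
have [|W [G [hG lG [hW lW WD We WG]]]] :=
  sweep sa lead e0 hD lD De (n := (e * p ^ s)%N).
  by rewrite leqnn leq_pmulr.
exists (fun i => W (e * i)%N); split=> //.
- apply: (hasse_contract e0 (leqnn _) hW) => i x iN ei.
  rewrite WG ?dilate_ndvd // ltn_neqAle iN andbT.
  by apply: contra ei => /eqP->; rewrite dvdn_mulr.
- by rewrite muln1.
- move=> i x ips Ix; apply: lW => //.
  rewrite -ltnS prednK; last by rewrite muln_gt0 e0 ps0.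
  by rewrite ltn_pmul2l // -(prednK (ps0 s)) ltnS.
Qed.
End Contraction.

Section Ell.
Set Implicit Arguments.
Unset Strict Implicit.
Lemma leq_inf_ell (A : comPzRingType) m (D : 'I_m.+1 -> A -> A) e i x :
  leq_inf e (ell D) -> (0 < i < e)%N -> (i <= m)%N -> D (inord i) x = 0.
Proof.
rewrite /ell => eD /andP[i0 ie] im.
have [//|nD] := pselect (D (inord i) = fun=> 0); first by move->.
have Di : nonzero_at D i by rewrite /nonzero_at i0 im; apply/asboolP.
move: eD; case: pselect => [exD|[]]; last by exists i.
by case: ex_minnP => h _ /(_ i Di) hi /=; lia.
Qed.
End Ell.

Theorem theorem3p14 (k A : comPzRingType) (phi : {rmorphism k -> A})
    (I : set A) (p a e s : nat) (D : 'I_(e * p ^ s).+1 -> A -> A) :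
  is_ideal I ->
  (2 <= p)%N -> (1 <= a)%N -> condH phi I p a ->
  (1 <= e)%N -> (1 <= s)%N -> (s <= a)%N ->
  HS phi D ->
  r_logarithmic I (e * p ^ s - 1) D ->
  leq_inf e (ell D) ->
  exists D' : 'I_(p ^ s).+1 -> A -> A,
    [/\ HS phi D',
        D' (inord 1) = D (inord e),
        r_logarithmic I (p ^ s - 1) D'
      & exists H : A -> A,
          [/\ is_diffop phi H, logarithmic I H
            & D' (inord (p ^ s)) = D (inord (e * p ^ s)) \+ H]].
Proof.
move=> idealI p2 _ condHI e0 _ sa hD lD eD.
set N := (e * p ^ s)%N in D hD lD eD *.
have ps0 : (0 < p ^ s)%N by rewrite expn_gt0; lia.
have eN : (e <= N)%N by rewrite leq_pmulr.
have hD' := HS_hasse hD.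
have [||E [hE E1 lE EN]] := contraction idealI p2 condHI sa e0 hD'.
- move=> i x iN Ix; apply: (lD (inord i)); last by exists x.
  by rewrite inordK; lia.
- by move=> i x ie; apply: leq_inf_ell eD _ _ => //; lia.
exists (fun i : 'I_(p ^ s).+1 => E i); split.
- exact: hasse_HS.
- by rewrite inordK ?ltnS //; apply: funext.
- by move=> i ips _ [x Ix <-]; apply: lE => //; lia.
exists (fun x => E (p ^ s)%N x - D (inord N) x); split.
- have [kE _ _] := hE; have [kD _ _] := hD'; split.
    by apply: klinearB; [exact: kE|exact: kD].
  exists N.
  apply: (@eq_diffop _ _ (fun x => E (p ^ s)%N x + -1 * D (inord N) x)).
    by move=> x; rewrite mulN1r.
  apply: diffop_leD; last by apply: diffop_leZ; apply: hasse_diffop hD' _.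
  apply: (@diffop_le_leq _ (p ^ s)%N); first by rewrite leq_pmull.
  exact: hasse_diffop hE _.
- by move=> _ [x Ix <-]; apply: EN.
- by rewrite inordK ?ltnS //; apply: funext => x; rewrite /= addrC subrK.
Qed.
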